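(* Let $TRI$ be the infinite triangular grid. Then $\frac{3}{7} \le \textrm{ERR:LD\%}(TRI) \le \frac{1}{2}$.
   Context: $TRI$ is the infinite triangular grid, the 6-regular graph of vertices and edges of the tiling of the plane by equilateral triangles (equivalently, vertex set $\mathbb{Z}^2$ with $p,q$ adjacent iff $p-q\in\{\pm(1,0),\pm(0,1),\pm(1,1)\}$). $N(v)$ is the open neighborhood of $v$ and $N[v]=N(v)\cup\{v\}$. ERR:LD sets (error-correcting locating-dominating sets) of a graph $G$: $S \subseteq V(G)$ is a set of detectors. At most one intruder is present, located at some vertex. A correctly working detector $v\in S$ transmits $2$ if the intruder is at $v$, $1$ if the intruder is in $N(v)$, and $0$ otherwise. At most one detector may transmit an incorrect value. $S$ is an ERR:LD set if, from the transmitted values, one can always determine whether an intruder is present and, if so, its exact location. Equivalently: $|N[v] \cap S| \ge 3$ for all $v\in V(G)$, and $|((N(v) \cap S) \triangle (N(u) \cap S)) - \{v,u\}| \ge 3 - |\{v,u\}\cap S|$ for all distinct $u,v\in V(G)$. $\textrm{ERR:LD\%}(G)$ denotes the minimum possible value of the density of an ERR:LD set $S$ for $G$, where the density of $S$ is the proportion of the vertices of $G$ that lie in $S$, formally $\limsup_{r\to\infty} \frac{|B_r(v)\cap S|}{|B_r(v)|}$ for any vertex $v\in V(G)$, with $B_r(v)=\{u\in V(G): d(u,v)\le r\}$. *)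

(* Defs.v *)
From mathcomp Require Import all_boot all_order all_algebra.
From mathcomp Require Import finmap.
From mathcomp Require Import all_classical all_reals all_analysis.

Set Implicit Arguments.
Unset Strict Implicit.
Unset Printing Implicit Defensive.

Import Order.TTheory GRing.Theory Num.Theory.

Local Open Scope classical_set_scope.
Local Open Scope ring_scope.

Section Graph.
(* A graph is given by its adjacency relation. *)
Context {V : choiceType} (adj : rel V).

(* [Some u] is an intruder at [u] and [None] the absence of an intruder. *)
Definition correct_signal (x : option V) (v : V) : 'I_3 :=
  if x is Some u then
    if u == v then inord 2 else if adj v u then inord 1 else inord 0
  else inord 0.

(* The values [t v] are only looked at for [v] in [S]. *)
Definition consistent (S : set V) (x : option V) (t : V -> 'I_3) : Prop :=
  forall v w, S v -> S w ->
    t v != correct_signal x v -> t w != correct_signal x w -> v = w.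

(* The transmitted values determine the presence and location of the intruder,
   whichever detector (if any) is faulty. *)
Definition ERR_LD (S : set V) : Prop :=
  forall (x y : option V) (t : V -> 'I_3),
    consistent S x t -> consistent S y t -> x = y.

(* d(u, v) <= r, expressed by a walk of length at most r from v to u. *)
Definition gball (v : V) (r : nat) : set V :=
  [set u | exists p : seq V,
             [/\ path adj v p, last v p = u & (size p <= r)%N]].

(* [fset_set] is only meaningful on finite sets, so this is the density when
   the graph is locally finite. *)
Definition density (R : realType) (v : V) (S : set V) : \bar R :=
  limn_esup (fun r : nat =>
    ((#|` fset_set (gball v r `&` S)|%:R / #|` fset_set (gball v r)|%:R : R)%:E)).

Definition ERR_LD_density (R : realType) (v : V) : \bar R :=
  ereal_inf [set density R v S | S in ERR_LD].

End Graph.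

Definition tri_adj : rel (int * int)%type := fun p q =>
  p - q \in [:: (1, 0); (- 1, 0); (0, 1); (0, - 1); (1, 1); (- 1, - 1)].

(* Main.v *)
(* Lower bound: an ERR:LD set S meets every closed neighbourhood in at least
   three vertices, and a vertex lies in seven closed neighbourhoods, so
   3 |B_r| <= 7 |S /\ B_(r+1)|; since |B_(r+1)| = |B_r| + O(r) and |B_r| >= r^2,
   the density of S is at least 3/7.
   Upper bound: the union S of every other line in one of the three directions
   is an ERR:LD set.  A unit translation maps S into its complement, so
   2 |S /\ B_r| <= |B_(r+1)| and the density of S is at most 1/2. *)
Require Import Defs.
From mathcomp Require Import all_boot all_order all_algebra zify ring lra.
From mathcomp Require Import finmap.
From mathcomp Require Import all_classical all_reals all_analysis.

Set Implicit Arguments.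
Unset Strict Implicit.
Unset Printing Implicit Defensive.

Import Order.TTheory GRing.Theory Num.Theory.
Import numFieldNormedType.Exports.

Local Open Scope ring_scope.

(** * Separation and domination in an arbitrary graph *)

Section Graph.
Context {V : choiceType} (adj : rel V).

Lemma correct_signal_Some_neq (u w v : V) : irreflexive adj ->
  (correct_signal adj (Some u) v != correct_signal adj (Some w) v) =
  ((u == v) != (w == v)) || (adj v u != adj v w).
Proof.
move=> adjxx; rewrite /correct_signal -val_eqE.
case: (eqVneq u v) => [->|_]; case: (eqVneq w v) => [->|_];
  rewrite ?adjxx ?eqxx //=; case: (adj v u); case: (adj v w);
  by rewrite /= ?inordK.
Qed.

Lemma correct_signal_None_neq (w v : V) :
  (correct_signal adj (Some w) v != correct_signal adj None v) =
  (w == v) || adj v w.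
Proof.
rewrite /correct_signal -val_eqE.
by case: (w == v); case: (adj v w); rewrite /= ?inordK.
Qed.

Definition ERR_separated (S : set V) (x y : option V) :=
  exists a b c : V, [/\ S a, S b & S c] /\ [/\ a != b, a != c & b != c] /\
    [/\ correct_signal adj x a != correct_signal adj y a,
        correct_signal adj x b != correct_signal adj y b &
        correct_signal adj x c != correct_signal adj y c].

Lemma ERR_separatedC S x y : ERR_separated S x y -> ERR_separated S y x.
Proof.
move=> [a [b [c [Sabc [abc [xya xyb xyc]]]]]].
by exists a, b, c; do 2!split=> //; split; rewrite eq_sym.
Qed.

(* Pigeonhole: of three detectors that separate x from y, two would be faulty
   for the same one of x and y. *)
Lemma ERR_separated_LD S :
  (forall x y, x != y -> ERR_separated S x y) -> ERR_LD adj S.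
Proof.
move=> sepS x y t tx ty; apply/eqP/negP => /negP /sepS.
move=> [a [b [c [[Sa Sb Sc] [[ab ac bc] [xya xyb xyc]]]]]].
have faulty v : correct_signal adj x v != correct_signal adj y v ->
    t v != correct_signal adj x v \/ t v != correct_signal adj y v.
  move=> xyv; case: (eqVneq (t v) (correct_signal adj x v)) => [->|].
    by right.
  by left.
have tx2 v w : S v -> S w -> v != w -> t v != correct_signal adj x v ->
    t w != correct_signal adj x w -> False.
  by move=> Sv Sw /eqP + tv tw; apply; exact: tx.
have ty2 v w : S v -> S w -> v != w -> t v != correct_signal adj y v ->
    t w != correct_signal adj y w -> False.
  by move=> Sv Sw /eqP + tv tw; apply; exact: ty.
by case: (faulty _ xya) => ta; case: (faulty _ xyb) => tb;
   case: (faulty _ xyc) => tc;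
   first [exact: tx2 ab _ _|exact: tx2 ac _ _|exact: tx2 bc _ _
         |exact: ty2 ab _ _|exact: ty2 ac _ _|exact: ty2 bc _ _].
Qed.

(* If the detectors of N[v] other than p were at most one, then p transmitting 0
   and the others signalling an intruder at v would be consistent with None. *)
Lemma ERR_LD_dominated2 S (v p : V) : ERR_LD adj S ->
  exists a b, [/\ S a, S b & a != b] /\ [/\ a != p & b != p] /\
    [/\ (v == a) || adj a v & (v == b) || adj b v].
Proof.
move=> ldS; apply: contrapT => no2.
pose t w := if w == p then correct_signal adj None w
            else correct_signal adj (Some v) w.
suff : Some v = None by [].
apply: (ldS _ _ t) => a b Sa Sb; rewrite /t.
  by case: (eqVneq a p) => [->|]; case: (eqVneq b p) => [->|]; rewrite ?eqxx.
case: (eqVneq a p) => [_|ap]; rewrite ?eqxx // correct_signal_None_neq => Na.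
case: (eqVneq b p) => [_|bp]; rewrite ?eqxx // correct_signal_None_neq => Nb.
by apply/eqP/negP => /negP ab; apply: no2; exists a, b.
Qed.

(** One detector [a] of N[v] is found first; excluding it as the possibly faulty one leaves two
    further detectors of N[v]. *)
Lemma ERR_LD_dominated3 S (v : V) : ERR_LD adj S ->
  exists s : seq V, [/\ uniq s, size s = 3%N,
    (forall a, a \in s -> S a) & (forall a, a \in s -> (v == a) || adj a v)].
Proof.
move=> ldS; have [a [_ [[Sa _ _] [_ [Na _]]]]] := ERR_LD_dominated2 v v ldS.
have [b [c [[Sb Sc bc] [[ba ca] [Nb Nc]]]]] := ERR_LD_dominated2 v a ldS.
exists [:: a; b; c]; split=> //=.
- by rewrite !inE (eq_sym a b) (eq_sym a c) (negPf ba) (negPf ca) bc.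
- by move=> d; rewrite !inE => /or3P[] /eqP->.
- by move=> d; rewrite !inE => /or3P[] /eqP->.
Qed.

End Graph.

(** * Limits superior *)

Lemma limn_esup_le (R : realType) (u v : nat -> \bar R) :
  (forall n, u n <= v n)%E -> (limn_esup u <= limn_esup v)%E.
Proof.
move=> uv; rewrite !limn_esup_lim.
apply: lee_lim; [exact: is_cvg_esups|exact: is_cvg_esups|].
apply: nearW => n; apply: ge_ereal_sup => _ [m nm <-].
by apply: (le_trans (uv m)); apply: ereal_sup_ubound; exists m.
Qed.

(** Absorbs the boundary error of order 1/r in both density estimates. *)
Lemma limn_esup_harmonic (R : realType) (a c : R) :
  limn_esup (fun n => (a + c * n.+1%:R^-1)%:E) = a%:E.
Proof.
suff /cvg_limn_einf_sup[] : ((a + c * n.+1%:R^-1)%:E @[n --> \oo] --> a%:E)%classic by [].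
apply/fine_cvgP; split; first by apply: nearW.
rewrite -[X in (_ --> X)%classic]addr0 -[X in a + X](mulr0 c).
by apply: cvgD; [exact: cvg_cst|apply: cvgM; [exact: cvg_cst|exact: cvg_harmonic]].
Qed.

(** * Shape and size of the balls of the triangular grid *)

Lemma tri_adjE (a b c d : int) : tri_adj (a, b) (c, d) =
  [|| (a - c == 1) && (b - d == 0), (a - c == -1) && (b - d == 0),
      (a - c == 0) && (b - d == 1), (a - c == 0) && (b - d == -1),
      (a - c == 1) && (b - d == 1) | (a - c == -1) && (b - d == -1)].
Proof. by rewrite /tri_adj -[_ - _]/(a - c, b - d) !inE !xpair_eqE. Qed.

Lemma tri_adjxx : irreflexive tri_adj.
Proof. by move=> [a b]; rewrite tri_adjE; lia. Qed.

(** This is the graph distance to the origin: the diagonal step (1, 1) makes coordinates of equal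
    sign cost their maximum, while coordinates of opposite signs cost the sum of their absolute
    values, which is [|p.1 - p.2|]. *)
Definition tri_norm (p : int * int) : int :=
  Num.max `|p.1| (Num.max `|p.2| `|p.1 - p.2|).

Lemma tri_norm_le p r :
  (tri_norm p <= r) = [&& `|p.1| <= r, `|p.2| <= r & `|p.1 - p.2| <= r].
Proof. by rewrite !ge_max. Qed.

(** An enumerated box around the ball, so that [hex_ball] is finite by construction. *)
Definition square (v : int * int) (r : nat) : seq (int * int) :=
  [seq (v.1 + (i%:Z - r%:Z), v.2 + (j%:Z - r%:Z)) |
    i <- iota 0 r.*2.+1, j <- iota 0 r.*2.+1].

Definition hex_ball (v : int * int) (r : nat) : {fset int * int} :=
  seq_fset tt [seq p <- square v r | tri_norm (p - v) <= r%:Z].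

Lemma in_hex_ball (v : int * int) r (p : int * int) :
  (p \in hex_ball v r) = (tri_norm (p - v) <= r).
Proof.
case: v p => [a b] [c d].
rewrite seq_fsetE mem_filter; case: (boolP (tri_norm _ <= _)) => pr //=.
move: pr; rewrite tri_norm_le /= => pr.
apply/allpairsP; exists (absz (c - a + r%:Z), absz (d - b + r%:Z)) => /=.
by split; rewrite ?inE ?mem_iota; [lia|lia|congr pair; lia].
Qed.

(** A step of a walk changes [tri_norm] by at most 1; conversely, a greedy walk lowers it by 1 at
    each step until it arrives. *)
Lemma gball_tri v r : gball tri_adj v r = [set` hex_ball v r]%classic.
Proof.
apply/seteqP; split=> [u|u] /=; rewrite in_hex_ball.
- move=> [p [+ <- pr]]; elim: p r v pr {u} => [|w p IHp] r v pr /=.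
    by rewrite subrr /tri_norm /=; lia.
  move=> /andP[vw wp]; case: r pr => // r pr.
  move: (IHp r w pr wp) vw; move: (last w p) => u {IHp wp pr}.
  case: u v w => [a b] [c d] [e f]; rewrite tri_adjE !tri_norm_le /=; lia.
- elim: r v => [|r IHr] v.
    move=> vu; exists [::]; split=> //=; case: v u vu => [a b] [c d].
    by rewrite !tri_norm_le /= => vu; congr pair; lia.
  move=> vu; suff [w [vw wu]] : exists w, (w == v) || tri_adj v w /\ tri_norm (u - w) <= r.
    case/orP: vw => [/eqP wv|vw]; have [p [wp pu pr]] := IHr w wu.
      by exists p; rewrite -wv; split=> //; exact: leqW.
    by exists (w :: p); split=> //=; rewrite vw.
  case: v u vu {IHr} => [a b] [c d]; rewrite !tri_norm_le /= => vu.
  (* The greedy step from v towards u: diagonal if both coordinates must move the same way, along an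
     axis otherwise, and none if u = v. *)
  pose w : int * int :=
    if (c == a) && (d == b) then (a, b)
    else if (a < c) && (b < d) then (a + 1, b + 1)
    else if (c < a) && (d < b) then (a - 1, b - 1)
    else if a < c then (a + 1, b) else if c < a then (a - 1, b)
    else if b < d then (a, b + 1) else (a, b - 1).
  exists w; rewrite /w; split;
   do !case: ifP => ?; rewrite ?tri_adjE ?xpair_eqE ?tri_norm_le /=; lia.
Qed.

Lemma fset_gballI (v : int * int) (r : nat) (S : set (int * int)) :
  fset_set (gball tri_adj v r `&` S)%classic
  = [fset p in hex_ball v r | p \in S]%fset.
Proof.
rewrite gball_tri -[RHS]set_fsetK; congr fset_set; apply/seteqP; split=> p /=.
  by move=> [pB /mem_set pS]; rewrite !inE; apply/andP.
by rewrite !inE => /andP[pB /set_mem].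
Qed.

(** The ball contains v + [0, r]^2, where the norm of the offset is just the maximum of its
    coordinates. *)
Lemma card_hex_ball_ge v r : (r.+1 ^ 2 <= #|` hex_ball v r|)%N.
Proof.
have -> : (r.+1 ^ 2)%N =
    size [seq (v.1 + i%:Z, v.2 + j%:Z) | i <- iota 0 r.+1, j <- iota 0 r.+1].
  by rewrite size_allpairs size_iota.
apply: uniq_leq_size.
  by rewrite allpairs_uniq ?iota_uniq // => -[i j] [k l] _ _ [] /addrI[->] /addrI[->].
case: v => [a b] _ /allpairsP[[i j] [+ + ->]]; rewrite !mem_iota in_hex_ball /=.
by rewrite tri_norm_le /=; lia.
Qed.

(** A point of norm exactly s = r + 1 relative to v lies on one of the six lines x = s, x = -s, y =
    s, y = -s, y - x = s, y - x = -s, and each contributes at most 2r + 3 points. *)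
Lemma card_hex_ballS v r :
  (#|` hex_ball v r.+1| <= #|` hex_ball v r| + 12 * r.+2)%N.
Proof.
have [I [szI memI]] : exists I : seq int, size I = (r.+1).*2.+1 /\
    (forall i : int, `|i| <= r.+1 -> i \in I).
  exists [seq i%:Z - r.+1%:Z | i <- iota 0 (r.+1).*2.+1].
  split=> [|i ir]; first by rewrite size_map size_iota.
  apply/mapP; exists (absz (i + r.+1%:Z)); last by lia.
  by rewrite mem_iota; lia.
pose s : int := r.+1%:Z.
pose L := [seq (v.1 + s, v.2 + i) | i <- I] ++ [seq (v.1 - s, v.2 + i) | i <- I]
  ++ [seq (v.1 + i, v.2 + s) | i <- I] ++ [seq (v.1 + i, v.2 - s) | i <- I]
  ++ [seq (v.1 + i, v.2 + (i + s)) | i <- I]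
  ++ [seq (v.1 + i, v.2 + (i - s)) | i <- I].
(* The six segments have 6(2r + 3) = 12(r + 2) - 6 entries in all; the bound is rounded up by 6. *)
have -> : (#|` hex_ball v r| + 12 * r.+2 = size (hex_ball v r ++ L) + 6)%N.
  by rewrite !size_cat !size_map szI; lia.
apply: leq_trans (leq_addr _ _); apply: uniq_leq_size => // p.
rewrite mem_cat !in_hex_ball.
case: (boolP (tri_norm (p - v) <= r%:Z)) => //= gt_r le_s.
have mem_line (f : int -> int * int) (i : int) :
    `|i| <= s -> p = f i -> p \in [seq f i | i <- I].
  by move=> /memI iI ->; exact: map_f.
move: gt_r le_s mem_line; rewrite /L {L}.
case: v p => [a b] [c d]; rewrite !tri_norm_le /= -/s => gt_r le_s mem_line.
rewrite !mem_cat.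
have : [|| c - a == s, c - a == - s, d - b == s, d - b == - s,
           (d - b) - (c - a) == s | (d - b) - (c - a) == - s].
  by rewrite /s in le_s *; lia.
case/or4P => [e|e|e|/or3P[] e].
- by rewrite (mem_line _ (d - b)) //; [lia|congr pair; lia].
- by rewrite [X in _ || (X || _)](mem_line _ (d - b)) ?orbT //; [lia|congr pair; lia].
- by rewrite [X in _ || (_ || (X || _))](mem_line _ (c - a)) ?orbT //; [lia|congr pair; lia].
- by rewrite [X in _ || (_ || (_ || (X || _)))](mem_line _ (c - a)) ?orbT //;
    [lia|congr pair; lia].
- by rewrite [X in _ || (_ || (_ || (_ || (X || _))))](mem_line _ (c - a)) ?orbT //;
    [lia|congr pair; lia].
- by rewrite [X in _ || (_ || (_ || (_ || (_ || X))))](mem_line _ (c - a)) ?orbT //;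
    [lia|congr pair; lia].
Qed.

(** * Double counting for the lower bound *)

Definition closed_offsets : seq (int * int) :=
  [:: (0, 0); (1, 0); (- 1, 0); (0, 1); (0, - 1); (1, 1); (- 1, - 1)].

Lemma hex_ball_shift (v p o : int * int) (r : nat) :
  o \in closed_offsets -> p \in hex_ball v r -> p + o \in hex_ball v r.+1.
Proof.
case: v p o => [a b] [c d] [i j].
rewrite !inE !xpair_eqE !in_hex_ball !tri_norm_le /=; lia.
Qed.

(** Count the pairs (p, o) with p in the ball, o an offset and p + o in S. Each p has at least three
    such o, and for each of the seven o the translation by o is injective into the part of S in the
    next ball. *)
Lemma dominating_card (S : set (int * int)) (v : int * int) (r : nat) :
  ERR_LD tri_adj S ->
  (3 * #|` hex_ball v r| <= 7 * #|` [fset p in hex_ball v r.+1 | p \in S]%fset|)%N.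
Proof.
move=> ldS; set B' := [fset p in _ | _]%fset.
have dom p : (3 <= \sum_(o <- closed_offsets) (p + o \in S)%R)%N.
  have [s [s_uniq s3 sS sN]] := ERR_LD_dominated3 p ldS.
  rewrite -big_mkcond sum1_count -size_filter -s3 -(size_map (fun a => a - p)).
  apply: uniq_leq_size => [|_ /mapP[a as_ ->]]; first by rewrite map_inj_uniq //; exact: addIr.
  rewrite mem_filter addrC subrK mem_set /=; last exact: sS.
  move: (sN a as_); case: p a {sN as_} => [a b] [c d].
  rewrite tri_adjE xpair_eqE !inE !xpair_eqE /=; lia.
apply: (@leq_trans (\sum_(p <- hex_ball v r) \sum_(o <- closed_offsets) (p + o \in S)%R)%N).
  rewrite mulnC card_fset_sum1 big_distrl /=; apply: leq_sum => p _.
  by rewrite mul1n.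
rewrite exchange_big.
apply: (@leq_trans (\sum_(o <- closed_offsets) #|` B'|)%N); last first.
  by rewrite big_const_seq iter_addn_0 mulnC.
rewrite big_seq [leqRHS]big_seq; apply: leq_sum => o oO.
rewrite -big_mkcond sum1_count -size_filter -(size_map (fun p => p + o)).
apply: uniq_leq_size.
  by rewrite (map_inj_uniq (@addIr _ o)) filter_uniq ?fset_uniq.
move=> _ /mapP[p + ->]; rewrite mem_filter => /andP[poS pB].
by rewrite !inE; apply/andP; split=> //; exact: hex_ball_shift.
Qed.

(** * The striped detector set *)

Definition stripes : set (int * int) := [set p | (p.1 %% 2)%Z = 0]%classic.

(** A vertex on a stripe is dominated by itself and its two neighbours on that stripe; a vertex off
    the stripes has two neighbours on each of the two adjacent stripes, of which three are taken. *)
Lemma stripes_separated_None (w : int * int) :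
  ERR_separated tri_adj stripes (Some w) None.
Proof.
case: w => [a b]; have [a0|a1] := eqVneq (a %% 2)%Z 0.
  exists (a, b), (a, b + 1), (a, b - 1).
  rewrite !correct_signal_None_neq !xpair_eqE !tri_adjE /stripes /=.
  by split; [split; lia|split; split; lia].
exists (a - 1, b), (a + 1, b), (a + 1, b + 1).
rewrite !correct_signal_None_neq !xpair_eqE !tri_adjE /stripes /=.
by split; [split; lia|split; split; lia].
Qed.

(** The lexicographic order tells which side is far from the other point: when a < c, the column a -
    1 is out of reach of (c, d) and the column c + 1 out of reach of (a, b). A detector at one of
    the two points always separates them, since only it transmits 2. *)
Lemma stripes_separated_lt (a b c d : int) : (a < c) || (a == c) && (b < d) ->
  ERR_separated tri_adj stripes (Some (a, b)) (Some (c, d)).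
Proof.
move=> lt_ab.
have [a0|a1] := eqVneq (a %% 2)%Z 0; have [c0|c1] := eqVneq (c %% 2)%Z 0.
- have [ac|ac] := eqVneq a c.
    exists (a, b), (c, d), (a, b - 1); rewrite !(correct_signal_Some_neq _ _ _ tri_adjxx).
    by rewrite !xpair_eqE !tri_adjE /stripes /=; do ![split]; lia.
  exists (a, b), (a, b + 1), (a, b - 1); rewrite !(correct_signal_Some_neq _ _ _ tri_adjxx).
  by rewrite !xpair_eqE !tri_adjE /stripes /=; do ![split]; lia.
- exists (a, b), (c + 1, d), (c + 1, d + 1).
  rewrite !(correct_signal_Some_neq _ _ _ tri_adjxx).
  by rewrite !xpair_eqE !tri_adjE /stripes /=; do ![split]; lia.
- exists (c, d), (a - 1, b), (a - 1, b - 1).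
  rewrite !(correct_signal_Some_neq _ _ _ tri_adjxx).
  by rewrite !xpair_eqE !tri_adjE /stripes /=; do ![split]; lia.
- have [ac|ac] := eqVneq a c.
    (* Since b < d, the first two are adjacent to (a, b) but too low for (a, d), and the third is
       adjacent to (a, d) but too high for (a, b). *)
    exists (a - 1, b - 1), (a + 1, b), (a - 1, d).
    rewrite !(correct_signal_Some_neq _ _ _ tri_adjxx).
    by rewrite !xpair_eqE !tri_adjE /stripes /=; do ![split]; lia.
  exists (a - 1, b), (a - 1, b - 1), (c + 1, d).
  rewrite !(correct_signal_Some_neq _ _ _ tri_adjxx).
  by rewrite !xpair_eqE !tri_adjE /stripes /=; do ![split]; lia.
Qed.

Lemma stripes_ERR_LD : ERR_LD tri_adj stripes.
Proof.
apply: ERR_separated_LD => -[[a b]|] [[c d]|] //= xy.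
- have [lt|ge] := boolP ((a < c) || (a == c) && (b < d)).
    exact: stripes_separated_lt.
  apply: ERR_separatedC; apply: stripes_separated_lt.
  have : (a, b) != (c, d) by apply: contra_neq xy => ->.
  by rewrite xpair_eqE; lia.
- exact: stripes_separated_None.
- by apply: ERR_separatedC; exact: stripes_separated_None.
Qed.

Lemma stripes_card (v : int * int) (r : nat) :
  (2 * #|` [fset p in hex_ball v r | p \in stripes]%fset| <= #|` hex_ball v r.+1|)%N.
Proof.
set P := [fset p in _ | _]%fset.
pose sh (p : int * int) := (p.1 + 1, p.2).
have sh_inj : injective sh by move=> [a b] [c d] [/addIr-> ->].
have -> : (2 * #|` P| = size (P ++ map sh P))%N by rewrite size_cat size_map mul2n addnn.
apply: uniq_leq_size.
  rewrite cat_uniq map_inj_uniq // !fset_uniq /= andbT.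
  apply/hasPn => _ /mapP[p + ->].
  rewrite !inE => /andP[_ /set_mem]; rewrite /stripes /= => p0.
  by apply/negP => /andP[_ /set_mem] /=; lia.
have PB p : p \in P -> tri_norm (p - v) <= r.
  by rewrite !inE => /andP[+ _]; rewrite -in_hex_ball.
move=> p; rewrite mem_cat in_hex_ball => /orP[/PB|/mapP[q /PB + ->]].
  by rewrite !tri_norm_le; lia.
by case: v q {PB P} => [a b] [c d]; rewrite !tri_norm_le /=; lia.
Qed.

(** * From counts to densities *)

Lemma density_triE (R : realType) (v : int * int) (S : set (int * int)) :
  density tri_adj R v S = limn_esup (fun r =>
    (#|` [fset p in hex_ball v r | p \in S]%fset|%:R / #|` hex_ball v r|%:R)%:E).
Proof.
rewrite /density; congr limn_esup; apply/funext => r.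
by rewrite fset_gballI gball_tri set_fsetK.
Qed.

Lemma dominating_density (R : realType) (v : int * int) (S : set (int * int)) :
  ERR_LD tri_adj S -> ((3 / 7)%:E <= density tri_adj R v S)%E.
Proof.
move=> ldS; rewrite density_triE -(limn_esup_harmonic (3 / 7) (- 12)).
apply: limn_esup_le => -[|r]; rewrite lee_fin.
  (* At radius 0 there is no smaller ball to count in, but the bound 3/7 - 12 is negative. *)
  by apply: (@le_trans _ _ 0); [lra|exact: divr_ge0].
have := dominating_card v r ldS.
have := card_hex_ballS v r.
have := card_hex_ball_ge v r.+1.
rewrite -!(ler_nat R) natrX !natrM natrD !natrM.
move: (#|` hex_ball v r.+1|%:R) (#|` hex_ball v r|%:R) => n n'.
move: (#|` _|%:R) => s.
have : 0 < r.+2%:R :> R by rewrite ltr0n.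
move: r.+2%:R => K K0 nK nn' n's.
have n0 : 0 < n by apply: lt_le_trans nK; rewrite exprn_gt0.
(* With K = r + 2, the counts give 7s >= 3n' >= 3n - 36K, and K <= n / K makes the loss a multiple
   of n / K; 36/7 is rounded up to 12. *)
have Kq : K <= n / K by rewrite ler_pdivlMr // -expr2.
rewrite ler_pdivlMr // (_ : _ * n = 3 / 7 * n - 12 * (n / K)); [lra|ring].
Qed.

Lemma stripes_density (R : realType) (v : int * int) :
  (density tri_adj R v stripes <= (1 / 2)%:E)%E.
Proof.
rewrite density_triE -(limn_esup_harmonic (1 / 2) 12).
apply: limn_esup_le => r; rewrite lee_fin.
have := stripes_card v r.
have := card_hex_ballS v r.
have := card_hex_ball_ge v r.
rewrite -!(ler_nat R) natrX !natrM natrD !natrM -(natr1 r.+1).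
move: (#|` hex_ball v r|%:R) (#|` hex_ball v r.+1|%:R) => n n'.
move: (#|` _|%:R) => s.
(* Here K = r + 1 and 2s <= n' <= n + 12(K + 1); K >= 1 turns the error 6(K + 1) into at most
   12K. *)
have : 1 <= r.+1%:R :> R by rewrite ler1n.
move: r.+1%:R => K K1 nK nn' n's.
have K0 : 0 < K by exact: lt_le_trans K1.
have n0 : 0 < n by apply: lt_le_trans nK; rewrite exprn_gt0.
have Kq : K <= n / K by rewrite ler_pdivlMr // -expr2.
rewrite ler_pdivrMr // (_ : _ * n = 1 / 2 * n + 12 * (n / K)); [lra|ring].
Qed.

Theorem theorem4p7 (R : realType) (v : int * int) :
  ((3 / 7 : R)%:E <= ERR_LD_density tri_adj R v)%E /\
  (ERR_LD_density tri_adj R v <= (1 / 2 : R)%:E)%E.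
Proof.
split; first by apply/ereal_infP => _ [S ldS <-]; exact: dominating_density.
apply: le_trans (stripes_density R v); apply: ereal_inf_lbound.
by exists stripes => //; exact: stripes_ERR_LD.
Qed.
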